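(* Let $X$ be an infinite-dimensional normed space and $\mathcal{F}$ a free filter on $\mathbb{N}$. If the stationary uniform $\mathcal{F}$-boundedness principle holds for $X$, then $\mathcal{F}$ is a rapid$^+$ filter.
   Context: $\mathbb{N}=\{0,1,2,\ldots\}$. A filter on $\mathbb{N}$ is a non-empty, upwards closed family $\mathcal{F}\subsetneq P(\mathbb{N})$ closed under finite intersections; it is free if it contains all cofinite subsets of $\mathbb{N}$. A set $A\subseteq\mathbb{N}$ is $\mathcal{F}$-stationary if $\mathbb{N}\setminus A\notin\mathcal{F}$. $(\forall_{\mathcal{F}}\, i\in\mathbb{N})\,\Phi(i)$ means $\{i\in\mathbb{N}:\Phi(i)\}\in\mathcal{F}$. For infinite $A\subseteq\mathbb{N}$, $\eta_A:\mathbb{N}\to A$ is the unique strictly increasing surjection. $\mathcal{F}$ is a rapid$^+$ filter if for every $\mathcal{F}$-stationary set $I$ and every strictly increasing $f:\mathbb{N}\to\mathbb{N}$ there is an $\mathcal{F}$-stationary set $B\subseteq I$ with $f(n)\le\eta_B(n)$ for all $n$. For topological vector spaces $X,Y$, $\mathcal{L}(X,Y)$ is the space of continuous linear maps. A sequence $(y_i)_i$ in $Y$ is $\mathcal{F}$-bounded if for every $0$-neighbourhood $V$ in $Y$ there is $t>0$ with $ty_i\in V$ $(\forall_{\mathcal{F}}\, i\in\mathbb{N})$. A sequence $(T_i)_i$ in $\mathcal{L}(X,Y)$ is pointwise $\mathcal{F}$-bounded if $(T_i(x))_i$ is $\mathcal{F}$-bounded for every $x\in X$; it is $\mathcal{F}$-stationary-equicontinuous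 if for every $\mathcal{F}$-stationary set $I$ and every $0$-neighbourhood $V$ in $Y$ there are a $0$-neighbourhood $U$ in $X$ and an $\mathcal{F}$-stationary set $J\subseteq I$ with $T_i[U]\subseteq V$ for all $i\in J$. The stationary uniform $\mathcal{F}$-boundedness principle holds for $X$ if for every locally convex space $Y$, every pointwise $\mathcal{F}$-bounded sequence in $\mathcal{L}(X,Y)$ is $\mathcal{F}$-stationary-equicontinuous. *)

(* Defs.v *)
From mathcomp Require Import all_boot all_order all_algebra.
From mathcomp Require Import all_classical all_reals all_analysis.
From mathcomp Require Import complex.

Set Implicit Arguments.
Unset Strict Implicit.
Unset Printing Implicit Defensive.

Import Order.TTheory GRing.Theory Num.Theory.
Import numFieldNormedType.Exports.

Local Open Scope classical_set_scope.
Local Open Scope ring_scope.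

(* [ProperFilter F] already says that [F] is a filter with [set0] not in [F],
   that is, a non-empty proper family. *)
Definition free_filter (F : set_system nat) :=
  forall A : set nat, cofinite_set A -> F A.

Definition stationary (F : set_system nat) (A : set nat) := ~ F (~` A).

(* [eta_of A e] says that e is eta_A, the (necessarily unique) strictly
   increasing surjection from nat onto A; it exists iff A is infinite. *)
Definition eta_of (A : set nat) (e : nat -> nat) :=
  increasing_seq e /\ range e = A.

(* When F is a free filter, every stationary set B is infinite, so asking for
   e with [eta_of B e] excludes no stationary set. *)
Definition rapid_plus (F : set_system nat) :=
  forall (I : set nat) (f : nat -> nat), stationary F I -> increasing_seq f ->
    exists B : set nat, [/\ stationary F B, B `<=` I &
      exists2 e : nat -> nat, eta_of B e & forall n, (f n <= e n)%N].

Definition infinite_dimensional (K : fieldType) (X : lmodType K) :=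
  ~ exists (n : nat) (v : 'I_n -> X),
      forall x : X, exists c : 'I_n -> K, x = \sum_(i < n) c i *: v i.

(* For K = R[i], [0 < t] forces t to be real. *)
Definition filter_bounded (K : numFieldType) (Y : topologicalLmodType K)
    (F : set_system nat) (y : nat -> Y) :=
  forall V : set Y, nbhs 0 V ->
    exists2 t : K, 0 < t & \forall i \near F, V (t *: y i).

Definition pointwise_filter_bounded (K : numFieldType)
    (X Y : topologicalLmodType K) (F : set_system nat)
    (T : nat -> {linear X -> Y}) :=
  forall x : X, filter_bounded F (fun i => T i x).

Definition stationary_equicontinuous (K : numFieldType)
    (X Y : topologicalLmodType K) (F : set_system nat)
    (T : nat -> {linear X -> Y}) :=
  forall (I : set nat) (V : set Y), stationary F I -> nbhs 0 V ->
    exists (U : set X) (J : set nat),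
      [/\ nbhs 0 U, stationary F J, J `<=` I &
          forall i, J i -> T i @` U `<=` V].

(* [tvsType K] is the library's type of locally convex spaces over K; they are
   not required to be Hausdorff. *)
Definition stationary_uniform_boundedness (K : numFieldType)
    (X : topologicalLmodType K) (F : set_system nat) :=
  forall (Y : tvsType K) (T : nat -> {linear X -> Y}),
    (forall i, continuous (T i)) ->
    pointwise_filter_bounded F T -> stationary_equicontinuous F T.

(* Main.v *)
Require Import Defs.
From HB Require Import structures.
From mathcomp Require Import all_boot all_order all_algebra.
From mathcomp Require Import all_classical all_reals all_analysis.
From mathcomp Require Import complex perm ring lra.

(* By a Dvoretzky-Rogers argument, a real infinite-dimensional normed space
   carries, for every m, functionals psi_1, ..., psi_m of norm at least 1/4 with
   sum_j |psi_j x|^2 <= |x|^2, so that at most (n |x|)^2 of the n psi_j exceed 1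
   at x, whatever m is. If F is not rapid+, as witnessed by I and f, cut the
   integers into finite blocks whose endpoints grow much faster than f, and let
   T_i be n times such a functional when i in I is in the n-th block, and 0 when
   i is not in I. For fixed x the indices i with |T_i x| > 1 form, up to a finite
   set, a subset of I too sparse to be stationary, so (T_i) is pointwise
   F-bounded; but the norms of the T_i tend to infinity along I, so (T_i) is not
   stationary-equicontinuous.

   The functionals psi_1, ..., psi_k are coordinates of a contraction
   T : X -> R^2k whose determinant on a fixed 2k-dimensional subspace is nearly
   maximal. For complex spaces take phi(x) - i phi(ix), with phi real-linear. *)

Import Order.TTheory GRing.Theory Num.Theory.
Import numFieldNormedType.Exports.
Local Open Scope classical_set_scope.
Local Open Scope ring_scope.

(** * The Hahn-Banach theorem *)

Section HahnBanach.
Variables (R : realType) (V : lmodType R) (p : V -> R).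
Hypothesis pD : forall x y, p (x + y) <= p x + p y.
Hypothesis pZ : forall a x, p (a *: x) = `|a| * p x.

(* Partial functionals are encoded by their graphs: a linear subspace of
   [V * R] on which [r <= p v] is automatically the graph of a function. *)
Definition dominated_graph (G : set (V * R)) :=
  (forall a u v, G u -> G v -> G (a *: u.1 + v.1, a * u.2 + v.2)) /\
  (forall u, G u -> u.2 <= p u.1).

Lemma dominated_graph0 G : dominated_graph G -> G !=set0 -> G (0, 0).
Proof.
move=> [Glin _] [u Gu].
by have := Glin (-1) _ _ Gu Gu; rewrite scaleN1r mulN1r !addNr.
Qed.

Lemma dominated_graphZ G a u : dominated_graph G -> G u ->
  G (a *: u.1, a * u.2).
Proof.
move=> Gd Gu; have G0 : G (0, 0) by apply: dominated_graph0 => //; exists u.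
by have := Gd.1 a _ _ Gu G0; rewrite !addr0.
Qed.

Lemma dominated_graphB G u v : dominated_graph G -> G u -> G v ->
  G (u.1 - v.1, u.2 - v.2).
Proof.
move=> Gd Gu Gv; have := Gd.1 (-1) _ _ Gv Gu.
by rewrite scaleN1r mulN1r ![- _ + _]addrC.
Qed.

Lemma dominated_graph_fun G v r s : dominated_graph G ->
  G (v, r) -> G (v, s) -> r = s.
Proof.
move=> Gd Gr Gs.
have p0 : p 0 = 0 by rewrite -(scale0r 0) pZ normr0 mul0r.
have := Gd.2 _ (dominated_graphB _ _ _ Gd Gr Gs).
have := Gd.2 _ (dominated_graphB _ _ _ Gd Gs Gr).
by rewrite /= subrr p0 => ? ?; lra.
Qed.

(** Subadditivity puts each lower bound [u.2 - p (u.1 - v0)] for the value at [v0] below each upper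
    bound [p (w.1 + v0) - w.2]; homogeneity reduces every nonzero [t] to one of these two bounds. *)
Lemma dominated_graph_value G v0 : dominated_graph G -> G !=set0 ->
  exists r0, forall t u, G u -> u.2 + t * r0 <= p (u.1 + t *: v0).
Proof.
move=> Gd G0; pose S := [set u.2 - p (u.1 - v0) | u in G].
have ubS w : G w -> ubound S (p (w.1 + v0) - w.2).
  move=> Gw _ [u Gu <-].
  have /= := Gd.2 _ (Gd.1 1 _ _ Gu Gw); rewrite scale1r mul1r => h.
  have := pD (u.1 - v0) (w.1 + v0); rewrite addrACA addNr addr0; lra.
have S0 : S !=set0 by case: G0 => u Gu; exists (u.2 - p (u.1 - v0)), u.
have lo u : G u -> u.2 - p (u.1 - v0) <= sup S.
  move=> Gu; apply: ub_le_sup; last by exists u.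
  by case: G0 => w Gw; exists (p (w.1 + v0) - w.2); exact: ubS.
have hi w : G w -> sup S <= p (w.1 + v0) - w.2.
  by move=> Gw; apply: ge_sup => //; exact: ubS.
exists (sup S) => t u Gu.
have [t0|t0|->] := ltgtP t 0; last first.
- by rewrite mul0r addr0 scale0r addr0; exact: Gd.2.
- have := hi _ (dominated_graphZ _ t^-1 _ Gd Gu) => /=.
  rewrite lerBrDr -(ler_pM2l t0) mulrDr mulrA divff ?gt_eqF// mul1r => h.
  have -> : u.1 + t *: v0 = t *: (t^-1 *: u.1 + v0).
    by rewrite scalerDr scalerA divff ?gt_eqF// scale1r.
  by rewrite pZ gtr0_norm// addrC.
- have := lo _ (dominated_graphZ _ (- t)^-1 _ Gd Gu) => /=.
  have t0' : 0 < - t by rewrite oppr_gt0.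
  rewrite lerBlDr -(ler_pM2l t0') mulrDr mulrA divff ?gt_eqF// mul1r => h.
  have -> : u.1 + t *: v0 = - t *: ((- t)^-1 *: u.1 - v0).
    by rewrite scalerBr scalerA divff ?gt_eqF// scale1r scaleNr opprK.
  by rewrite pZ gtr0_norm// ; lra.
Qed.

Lemma dominated_graph_extend G v0 : dominated_graph G -> G !=set0 ->
  exists2 H, dominated_graph H & G `<=` H /\ exists r, H (v0, r).
Proof.
move=> Gd G0; have [r0 hr0] := dominated_graph_value G v0 Gd G0.
exists [set w | exists t, exists2 u, G u & w = (u.1 + t *: v0, u.2 + t * r0)].
  split.
    move=> a _ _ [t [u Gu ->]] [s [w Gw ->]] /=.
    exists (a * t + s), (a *: u.1 + w.1, a * u.2 + w.2); first exact: Gd.1.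
    by congr pair => /=; [rewrite scalerDr scalerA scalerDl addrACA|ring].
  by move=> _ [t [u Gu ->]]; exact: hr0.
split.
  by move=> [v r] Gu; exists 0, (v, r); rewrite // scale0r mul0r !addr0.
exists r0, 1, (0, 0); first exact: dominated_graph0.
by rewrite scale1r mul1r !add0r.
Qed.

Theorem hahn_banach_norming (e : V) : exists f : V -> R,
  [/\ forall a x y, f (a *: x + y) = a * f x + f y, f e = p e &
      forall x, `|f x| <= p x].
Proof.
have pge0 x : 0 <= p x.
  have p0 : p 0 = 0 by rewrite -(scale0r 0) pZ normr0 mul0r.
  have := pD x (- x); rewrite subrr p0 -scaleN1r pZ normrN1 mul1r; lra.
(* The union of the empty chain is empty, so [P] has to admit the empty graph; hence the condition
   at [e] is put on nonempty [G] only. *)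
pose P G := dominated_graph G /\ (G !=set0 -> G (e, p e)).
pose L : set (V * R) := [set w | exists t, w = (t *: e, t * p e)].
have PL : P L.
  split; last by move=> _; exists 1; rewrite scale1r mul1r.
  split=> [a _ _ [t ->] [s ->]|_ [t ->]] /=.
    by exists (a * t + s); rewrite scalerDl scalerA mulrDl mulrA.
  by rewrite pZ ler_wpM2r// ler_norm.
have [|G [[Gd Ge] Gmax]] := @Zorn_bigcup _ P.
  move=> C CP Ctot; split; last first.
    by move=> [w [G CG Gw]]; exists G => //; apply: (CP _ CG).2; exists w.
  split=> [a u v [G CG Gu] [H CH Hv]|u [G CG Gu]]; last exact: (CP _ CG).1.2.
  have [GH|HG] := Ctot _ _ CG CH.
    by exists H => //; apply: (CP _ CH).1.1 => //; exact: GH.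
  by exists G => //; apply: (CP _ CG).1.1 => //; exact: HG.
have G0 : G !=set0.
  apply: contrapT => G0; apply: (Gmax L) PL; split.
    by move=> w Gw; case: G0; exists w.
  by move=> LG; apply: G0; exists (e, p e); apply: LG; exists 1; rewrite scale1r mul1r.
have tot v : exists r, G (v, r).
  have [H Hd [GH [r Hr]]] := dominated_graph_extend G v Gd G0.
  apply: contrapT => nr; apply: (Gmax H).
    by split=> // HG; apply: nr; exists r; exact: HG.
  by split=> // _; apply/GH/Ge.
have [f Gf] := choice tot; exists f; split=> [a x y||x].
- exact: (dominated_graph_fun G (a *: x + y) _ _ Gd (Gf _)
    (Gd.1 a _ _ (Gf x) (Gf y))).
- exact: (dominated_graph_fun G e _ _ Gd (Gf _) (Ge G0)).
- rewrite ler_norml; have := Gd.2 _ (Gf x).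
  have := Gd.2 _ (dominated_graphZ _ (-1) _ Gd (Gf x)).
  by rewrite /= pZ normrN1 mul1r mulN1r => ? ?; apply/andP; split; lra.
Qed.

End HahnBanach.

(** * Householder reflections *)

Section SquareNorm.
Variable R : realType.

Definition sqn {n} (v : 'cV[R]_n) : R := \sum_i (v i 0) ^+ 2.

Lemma sqn_ge0 n (v : 'cV[R]_n) : 0 <= sqn v.
Proof. by apply: sumr_ge0 => i _; exact: sqr_ge0. Qed.

Lemma ler_sqn n (v : 'cV[R]_n) i : (v i 0) ^+ 2 <= sqn v.
Proof. by rewrite /sqn (bigD1 i)//= lerDl sumr_ge0// => j _; exact: sqr_ge0. Qed.

Lemma sqnZ n a (v : 'cV[R]_n) : sqn (a *: v) = a ^+ 2 * sqn v.
Proof. by rewrite /sqn mulr_sumr; apply: eq_bigr => i _; rewrite mxE exprMn. Qed.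

Lemma sqn_eq0 n (v : 'cV[R]_n) : sqn v = 0 -> v = 0.
Proof.
move=> v0; apply/matrixP => i j; rewrite ord1 mxE.
by apply/eqP; rewrite -sqrf_eq0 eq_le sqr_ge0 andbT -v0 ler_sqn.
Qed.

Lemma sqn_delta n (i : 'I_n) : sqn (delta_mx i 0) = 1.
Proof.
rewrite /sqn (bigD1 i)//= mxE !eqxx expr1n big1 ?addr0// => j ji.
by rewrite mxE (negbTE ji) expr0n.
Qed.

Definition dotv {n} (u v : 'cV[R]_n) : R := \sum_i u i 0 * v i 0.

Lemma mul_tr_dotv n (u v : 'cV[R]_n) : u^T *m v = (dotv u v)%:M.
Proof.
apply/matrixP => i j; rewrite !ord1 !mxE eqxx mulr1n.
by apply: eq_bigr => l _; rewrite mxE.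
Qed.

(* For [v = 0] the inverse is [0] and the reflection is the identity. *)
Definition reflection {n} (v : 'cV[R]_n) : 'M[R]_n :=
  1%:M - (2 / sqn v) *: (v *m v^T).

Lemma reflectionE n (v z : 'cV[R]_n) :
  reflection v *m z = z - (2 / sqn v * dotv v z) *: v.
Proof.
rewrite mulmxBl mul1mx -scalemxAl -mulmxA mul_tr_dotv mul_mx_scalar.
by rewrite scalerA.
Qed.

Lemma sqnB n (u z : 'cV[R]_n) : sqn (z - u) = sqn z - 2 * dotv u z + sqn u.
Proof.
rewrite /sqn /dotv mulr_sumr -sumrB -big_split /=; apply: eq_bigr => i _.
by rewrite !mxE; ring.
Qed.

Lemma dotvZl n a (u z : 'cV[R]_n) : dotv (a *: u) z = a * dotv u z.
Proof. by rewrite /dotv mulr_sumr; apply: eq_bigr => i _; rewrite mxE mulrA. Qed.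

Lemma sqn_reflection n (v z : 'cV[R]_n) : sqn (reflection v *m z) = sqn z.
Proof.
rewrite reflectionE sqnB sqnZ dotvZl.
by have [->|v0] := eqVneq (sqn v) 0; [rewrite invr0; ring|field].
Qed.

Lemma reflectionK n (v : 'cV[R]_n) : reflection v *m reflection v = 1%:M.
Proof.
rewrite /reflection mulmxBl !mulmxBr !mul1mx mulmx1 -scalemxAl -scalemxAr.
rewrite scalerA mulmxA -(mulmxA v) mul_tr_dotv mul_mx_scalar -scalemxAl.
rewrite scalerA.
have -> : dotv v v = sqn v by apply: eq_bigr => i _; rewrite expr2.
have [->|v0] := eqVneq (sqn v) 0.
  by rewrite invr0 !mulr0 !scale0r !subr0.
have -> : 2 / sqn v * (2 / sqn v) * sqn v = 2 / sqn v + 2 / sqn v by field.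
by rewrite scalerDl opprB addrK subrK.
Qed.

Lemma normr_det_reflection n (v : 'cV[R]_n) : `|\det (reflection v)| = 1.
Proof.
apply/eqP; rewrite -(@pexpr_eq1 _ _ 2)//.
by rewrite expr2 -normrM -det_mulmx reflectionK det1 normr1.
Qed.

(* Householder: the reflection sends the part of [z] supported on the
   coordinates [>= i] to a nonnegative multiple of the [i]-th basis vector. *)
Lemma householder n (z : 'cV[R]_n) (i : 'I_n) :
  exists v : 'cV[R]_n, (forall j : 'I_n, (j < i)%N -> v j 0 = 0) /\
    ((reflection v *m z) i 0) ^+ 2 = \sum_(j < n | (i <= j)%N) (z j 0) ^+ 2.
Proof.
pose w : 'cV[R]_n := \col_j (if (i <= j)%N then z j 0 else 0).
pose l := Num.sqrt (sqn w).
have wE : sqn w = \sum_(j < n | (i <= j)%N) (z j 0) ^+ 2.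
  rewrite /sqn [RHS]big_mkcond; apply: eq_bigr => j _; rewrite mxE.
  by case: ifP => // _; rewrite expr0n.
have l2 : l ^+ 2 = sqn w by rewrite sqr_sqrtr// sqn_ge0.
pose v := w - l *: delta_mx i 0.
have vz : dotv v z = sqn w - l * z i 0.
  rewrite /dotv (bigD1 i)//= /sqn [in RHS](bigD1 i)//= !mxE !eqxx leqnn/= mulr1.
  rewrite (eq_bigr (fun j => w j 0 ^+ 2)); first by ring.
  move=> j ji; rewrite !mxE (negbTE ji)/= mulr0 subr0.
  by case: ifP => _; rewrite ?expr2 ?mul0r.
have vv : sqn v = 2 * (sqn w - l * z i 0).
  have dw : dotv (l *: delta_mx i 0) w = l * z i 0.
    rewrite dotvZl /dotv (bigD1 i)//= !mxE !eqxx leqnn mul1r big1 ?addr0//.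
    by move=> j ji; rewrite mxE (negbTE ji) mul0r.
  have dd : sqn (l *: delta_mx i 0 : 'cV[R]_n) = sqn w.
    by rewrite sqnZ l2 sqn_delta mulr1.
  by rewrite sqnB dw dd; ring.
exists v; split.
  move=> j ji; rewrite !mxE leqNgt ji/= sub0r; case: eqP ji => [->|_ _].
    by rewrite ltnn.
  by rewrite mulr0 oppr0.
rewrite -wE -l2 reflectionE vz vv !mxE !eqxx leqnn mulr1.
(* In the degenerate case [v] vanishes, the reflection is the identity, and [z i 0] already equals
   [l]. *)
have [h|h] := eqVneq (sqn w - l * z i 0) 0.
  have : sqn v = 0 by rewrite vv h mulr0.
  move=> /sqn_eq0/matrixP/(_ i 0); rewrite !mxE !eqxx leqnn mulr1 => /eqP.
  by rewrite subr_eq0 => /eqP ->; rewrite subrr mulr0 subr0.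
congr (_ ^+ 2); field; exact: h.
Qed.

End SquareNorm.

Arguments sqn {R n}.
Arguments dotv {R n}.
Arguments reflection {R n}.

(** * The Dvoretzky-Rogers lemma *)

Section DvoretzkyRogers.
Variables (R : realType) (V : lmodType R) (p : V -> R).
Hypothesis pD : forall x y, p (x + y) <= p x + p y.
Hypothesis pZ : forall a x, p (a *: x) = `|a| * p x.
Hypothesis p0_eq0 : forall x, p x = 0 -> x = 0.
Hypothesis Vinf : infinite_dimensional V.

Let pge0 x : 0 <= p x.
Proof.
have p0 : p 0 = 0 by rewrite -(scale0r 0) pZ normr0 mul0r.
have := pD x (- x); rewrite subrr p0 -scaleN1r pZ normrN1 mul1r; lra.
Qed.

(** Infinite dimension gives a vector outside the span of the [e i]. Its residue [r x] is the next
    vector; a norming functional at [r x], corrected by the [phi i], is the next functional. *)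
Lemma biorthogonal_system n : exists (phi : nat -> V -> R) (e : nat -> V),
  [/\ forall i, scalar (phi i),
      forall i, exists C, forall x, `|phi i x| <= C * p x &
      forall i j, (i < n)%N -> (j < n)%N -> phi i (e j) = (i == j)%:R].
Proof.
elim: n => [|n [phi [e [lphi bphi ephi]]]].
  exists (fun _ _ => 0), (fun _ => 0); split=> //.
    by move=> i a x y; rewrite mulr0 addr0.
  by move=> i; exists 0 => x; rewrite normr0 mul0r.
have phi0 i : phi i 0 = 0.
  by have := lphi i (-1) 0 0; rewrite scaler0 addr0 mulN1r addNr.
have phi_sum i (c : 'I_n -> R) (v : 'I_n -> V) :
    phi i (\sum_j c j *: v j) = \sum_j c j * phi i (v j).
  apply: (big_ind2 (fun a b => phi i a = b)) => //.
    move=> x a y b <- <-; rewrite -[x]scale1r lphi mul1r.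
    by rewrite scale1r.
  by move=> j _; have := lphi i (c j) (v j) 0; rewrite !addr0 phi0 addr0.
have phiB i x y : phi i (x - y) = phi i x - phi i y.
  by rewrite addrC -scaleN1r lphi mulN1r addrC.
pose r x := x - \sum_(i < n) phi i x *: e i.
have phir i x : (i < n)%N -> phi i (r x) = 0.
  move=> ni; rewrite phiB phi_sum (bigD1 (Ordinal ni))//= big1.
    by rewrite ephi// eqxx mulr1 addr0 subrr.
  move=> j ji; rewrite ephi// (_ : (i == j) = false) ?mulr0//.
  by apply: contraNF ji => /eqP ij; apply/eqP/val_inj.
have [x rx0] : exists x, r x != 0.
  apply: contrapT => nr; apply: Vinf; exists n, (fun i => e i) => x.
  exists (fun i => phi i x); apply/eqP; rewrite -subr_eq0.
  by apply/negPn/negP => rx; apply: nr; exists x.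
have [f [lf fe fp]] := hahn_banach_norming _ _ _ pD pZ (r x).
have pr : 0 < p (r x).
  by rewrite lt_def pge0 andbT; apply: contraNN rx0 => /eqP/p0_eq0/eqP.
pose c := (p (r x))^-1.
(* The subtracted sum makes [psi] vanish at each earlier [e i]; it is zero at [r x], where [c] makes
   the value 1. *)
pose psi y := c * f y - \sum_(i < n) c * f (e i) * phi i y.
pose phi' i := if (i < n)%N then phi i else psi.
pose e' i := if (i < n)%N then e i else r x.
have lpsi : scalar psi.
  move=> a u v /=; rewrite /psi lf mulrBr mulr_sumr.
  under eq_bigr => i _ do rewrite lphi mulrDr.
  rewrite big_split/=.
  under [in RHS]eq_bigr => i _ do rewrite mulrCA.
  by rewrite mulrDr opprD [c * (a * f u)]mulrCA addrACA.
exists phi', e'; split.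
- by move=> i; rewrite /phi'; case: ifP.
- move=> i; rewrite /phi'; case: ifP => _ //.
  have [C hC] := choice bphi.
  exists (`|c| + \sum_(i < n) `|c * f (e i)| * C i) => y.
  rewrite mulrDl mulr_suml (le_trans (ler_normB _ _))// lerD//.
    by rewrite normrM ler_wpM2l.
  rewrite (le_trans (ler_norm_sum _ _ _))// ler_sum// => j _.
  by rewrite normrM -mulrA ler_wpM2l.
- move=> i j; rewrite !ltnS /phi' /e' (leq_eqVlt i) (leq_eqVlt j).
  move=> /predU1P[->|ni] /predU1P[->|nj].
  + rewrite !ltnn eqxx /psi fe big1 => [|l _]; last by rewrite phir ?mulr0.
    by rewrite subr0 mulVf// gt_eqF.
  + rewrite ltnn nj /psi (bigD1 (Ordinal nj))//= ephi// eqxx mulr1.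
    rewrite big1 ?addr0 ?subrr; first by rewrite gtn_eqF.
    move=> l lj; rewrite ephi// (_ : (val l == j) = false) ?mulr0//.
    by apply: contraNF lj => /eqP ij; apply/eqP/val_inj.
  + by rewrite ltnn ni phir// ltn_eqF.
  + by rewrite ni nj ephi.
Qed.

Definition euclidean_contraction {n} (T : V -> 'cV[R]_n) :=
  linear T /\ forall x, sqn (T x) <= p x ^+ 2.

Definition coordmx {n} (e : 'I_n -> V) (T : V -> 'cV[R]_n) : 'M[R]_n :=
  \matrix_(i, j) T (e j) i 0.

Lemma coordmx_mul n (e : 'I_n -> V) (A : 'M[R]_n) T :
  coordmx e (fun x => A *m T x) = A *m coordmx e T.
Proof.
by apply/matrixP => i j; rewrite !mxE; apply: eq_bigr => l _; rewrite !mxE.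
Qed.

Lemma normr_contraction_coord n (T : V -> 'cV[R]_n) x i :
  euclidean_contraction T -> `|T x i 0| <= p x.
Proof.
move=> [_ /(_ x) h]; rewrite -ler_sqr ?nnegrE// real_normK ?num_real//.
exact: le_trans (ler_sqn _ _ _ i) h.
Qed.

(** Leibniz expansion: each entry in column [j] is at most [p (e j)] in absolute value. *)
Lemma det_coordmx_bounded n (e : 'I_n -> V) : exists B, forall T,
  euclidean_contraction T -> `|\det (coordmx e T)| <= B.
Proof.
exists (\sum_(s : 'S_n) \prod_i p (e (s i))) => T cT.
rewrite (le_trans (ler_norm_sum _ _ _))// ler_sum// => s _.
rewrite normrM normrX normrN1 expr1n mul1r normr_prod ler_prod// => i _.
by rewrite normr_ge0 mxE normr_contraction_coord.
Qed.

Lemma det_coordmx_pos n : exists (e : 'I_n -> V) T,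
  euclidean_contraction T /\ 0 < `|\det (coordmx e T)|.
Proof.
have [phi [e [lphi bphi ephi]]] := biorthogonal_system n.
have [C hC] := choice bphi.
(* For [s] the sum of the [C i ^+ 2], the choice [c = 1 / (1 + s)] gives [c ^+ 2 * s <= 1] without a
   square root. *)
pose c := (1 + \sum_(i < n) C i ^+ 2)^-1.
have S0 : 0 <= \sum_(i < n) C i ^+ 2 by apply: sumr_ge0 => i _; exact: sqr_ge0.
have c0 : 0 < c by rewrite invr_gt0; lra.
exists (fun i => e i), (fun x => \col_i (c * phi i x)); split; last first.
  rewrite (_ : coordmx _ _ = c%:M) ?det_scalar ?normr_gt0 ?expf_neq0 ?gt_eqF//.
  apply/matrixP => i j; rewrite !mxE ephi// -val_eqE/=.
  by case: eqP => _; rewrite ?mulr1 ?mulr0.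
split=> [a x y|x].
  by apply/matrixP => i j; rewrite !mxE lphi mulrDr mulrCA.
have -> : sqn (\col_(i < n) (c * phi i x)) = c ^+ 2 * \sum_(i < n) phi i x ^+ 2.
  by rewrite /sqn mulr_sumr; apply: eq_bigr => i _; rewrite mxE exprMn.
have h : \sum_(i < n) phi i x ^+ 2 <= (\sum_(i < n) C i ^+ 2) * p x ^+ 2.
  rewrite mulr_suml ler_sum// => i _; rewrite -exprMn -(real_normK (num_real _)).
  by rewrite ler_sqr ?nnegrE// (le_trans _ (hC i x)).
apply: le_trans (ler_wpM2l (sqr_ge0 c) h) _; rewrite mulrA ler_piMl ?sqr_ge0//.
set s := \sum_(i < n) _ in c c0 S0 *.
have cs : c * (1 + s) = 1 by rewrite mulVf// gt_eqF//; lra.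
by rewrite expr2; nra.
Qed.

(** Approximating the supremum of the determinants spares a compactness argument; [3 / 2] is the
    gain from halving one coordinate and tripling another. *)
Definition near_maximal {n} (e : 'I_n -> V) (T : V -> 'cV[R]_n) :=
  euclidean_contraction T /\ forall T', euclidean_contraction T' ->
    `|\det (coordmx e T')| < 3 / 2 * `|\det (coordmx e T)|.

Lemma near_maximal_exists n : exists (e : 'I_n -> V) T, near_maximal e T.
Proof.
have [e [T0 [cT0 dT0]]] := det_coordmx_pos n; exists e.
have [B hB] := det_coordmx_bounded n e.
pose S := [set `|\det (coordmx e T)| | T in @euclidean_contraction n].
have ubS : ubound S B by move=> _ [T cT <-]; exact: hB.
have hS : has_sup S.
  by split; [exists `|\det (coordmx e T0)|, T0|exists B].
have sup_ub T : euclidean_contraction T -> `|\det (coordmx e T)| <= sup S.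
  by move=> cT; apply: sup_ubound => //; [exists B|exists T].
have s0 : 0 < sup S by exact: lt_le_trans (sup_ub _ cT0).
(* It suffices that the absolute determinant exceeds two thirds of the positive supremum. *)
have [|_ [T cT <-] hT] := sup_adherent (eps := sup S / 3) _ hS; first lra.
exists T; split=> // T' cT'; have := sup_ub _ cT'; lra.
Qed.

Lemma linear_mulmx n (A : 'M[R]_n) (T : V -> 'cV[R]_n) :
  linear T -> linear (fun x => A *m T x).
Proof. by move=> lT a x y /=; rewrite lT mulmxDr -scalemxAr. Qed.

(** Reflections preserve both [sqn] and the absolute determinant. *)
Lemma near_maximal_reflection n (e : 'I_n -> V) T v :
  near_maximal e T -> near_maximal e (fun x => reflection v *m T x).
Proof.
move=> [[lT cT] mT]; split.
  by split=> [|x]; [exact: linear_mulmx|rewrite sqn_reflection].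
by move=> T' /mT; rewrite coordmx_mul det_mulmx normrM normr_det_reflection mul1r.
Qed.

(* Otherwise halving the first [k] coordinates and tripling the last [k] ones
   gives a contraction with a determinant larger by the factor [(3/2)^k]. *)
Lemma near_maximal_tail k (e : 'I_(k + k) -> V) T : (0 < k)%N ->
  near_maximal e T ->
  exists2 y, p y <= 1 & 1 / 16 <= \sum_(i < k) (T y (rshift k i) 0) ^+ 2.
Proof.
move=> k0 [[lT cT] mT]; apply: contrapT => ny.
have small y : p y <= 1 -> \sum_(i < k) (T y (rshift k i) 0) ^+ 2 < 1 / 16.
  by move=> y1; rewrite ltNge; apply/negP => h; apply: ny; exists y.
pose d : 'rV[R]_(k + k) := \row_i (if (i < k)%N then 1 / 2 else 3).
have dl (i : 'I_k) : d 0 (lshift k i) = 1 / 2 by rewrite mxE /= ltn_ord.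
have dr (i : 'I_k) : d 0 (rshift k i) = 3.
  by rewrite mxE /= ltnNge leq_addr.
have cD : euclidean_contraction (fun x => diag_mx d *m T x).
  split=> [|x]; first exact: linear_mulmx.
  have TZ a : T (a *: x) = a *: T x.
    have T0 : T 0 = 0 by have := lT (-1) 0 0; rewrite scaler0 addr0 scaleN1r addNr.
    by have := lT a x 0; rewrite !addr0 T0 addr0.
  have tail : \sum_(i < k) (T x (rshift k i) 0) ^+ 2 <= p x ^+ 2 / 16.
    have [px|px] := eqVneq (p x) 0.
      have /sqn_eq0 -> : sqn (T x) = 0.
        by apply/eqP; rewrite eq_le sqn_ge0 andbT (le_trans (cT x))// px expr0n.
      rewrite px expr0n mul0r big1// => i _; by rewrite mxE expr0n.
    have px0 : 0 < p x by rewrite lt_def px pge0.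
    have /small : p ((p x)^-1 *: x) <= 1.
      by rewrite pZ ger0_norm ?invr_ge0// mulVf.
    rewrite TZ.
    under eq_bigr do rewrite mxE exprMn.
    rewrite -mulr_sumr exprVn mulrC ltr_pdivrMr ?exprn_gt0// => /ltW.
    by rewrite mul1r mulrC.
  rewrite mul_diag_mx /sqn big_split_ord /=.
  under eq_bigr do rewrite mxE dl exprMn.
  under [X in _ + X]eq_bigr do rewrite mxE dr exprMn.
  rewrite -!mulr_sumr; have := cT x; rewrite /sqn big_split_ord /=.
  (* From [s + t <= q] and [t <= q / 16], the new square norm [s / 4 + 9 * t] is at most
     [51 / 64 * q]. *)
  set s := \sum_(i < k) _; set t := \sum_(i < k) _ in tail *.
  have : 0 <= t by apply: sumr_ge0 => i _; exact: sqr_ge0.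
  move: (p x ^+ 2) tail => q; lra.
have dD : \det (diag_mx d) = (1 / 2 * 3) ^+ k.
  rewrite det_diag big_split_ord exprMn; congr (_ * _).
    by under eq_bigr do rewrite dl; rewrite prodr_const card_ord.
  by under eq_bigr do rewrite dr; rewrite prodr_const card_ord.
have := mT _ cD; rewrite coordmx_mul det_mulmx normrM dD.
have h : 3 / 2 <= (1 / 2 * 3 : R) ^+ k.
  rewrite -(prednK k0) exprS.
  have : 1 <= (1 / 2 * 3 : R) ^+ k.-1 by apply: exprn_ege1; lra.
  nra.
rewrite ger0_norm; last by apply: le_trans h; lra.
by apply/negP; rewrite -leNgt ler_wpM2r.
Qed.

(** Coordinates of a near-maximal map into dimension [k + k] are treated one at a time: step [i]
    reflects the whole part on coordinates [>= i], at a suitable unit-ball vector, into coordinate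
    [i]. As [i < k], that part includes the last [k] coordinates, whose square sum is at least
    [1 / 16]. *)
Theorem dvoretzky_rogers k : exists phi : 'I_k -> V -> R,
  [/\ forall j, scalar (phi j),
      forall x, \sum_j phi j x ^+ 2 <= p x ^+ 2 &
      forall j, exists2 y, p y <= 1 & 1 / 4 <= `|phi j y| ].
Proof.
have [->|k0] := posnP k.
  exists (fun _ _ => 0); split=> [[]//|x|[]//].
  by rewrite big_ord0 sqr_ge0.
have [e [T0 mT0]] := near_maximal_exists (k + k).
have [T [[lT cT] _] hT] : exists2 T, near_maximal e T &
    forall j : 'I_(k + k), (j < k)%N -> exists2 y, p y <= 1 & 1 / 4 <= `|T y j 0|.
  suff: forall i, (i <= k)%N -> exists2 T, near_maximal e T &
    forall j : 'I_(k + k), (j < i)%N -> exists2 y, p y <= 1 & 1 / 4 <= `|T y j 0|.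
    exact.
  elim=> [_|i IH ik]; first by exists T0.
  have [T mT hT] := IH (ltnW ik).
  have [y y1 hy] := near_maximal_tail k e T k0 mT.
  have ikk : (i < k + k)%N by rewrite ltn_addr.
  (* Since [v] vanishes before coordinate [i], the reflection leaves the coordinates already treated
     unchanged. *)
  have [v [v0 hv]] := householder _ _ (T y) (Ordinal ikk).
  exists (fun x => reflection v *m T x); first exact: near_maximal_reflection.
  move=> j; rewrite ltnS leq_eqVlt => /predU1P[ji|ji].
    exists y => //; have -> : j = Ordinal ikk by exact: val_inj.
    rewrite -ler_sqr ?nnegrE ?normr_ge0 ?divr_ge0 //.
    rewrite real_normK ?num_real// hv big_split_ord /=.
    apply: (@le_trans _ _ (1 / 16)); first by rewrite expr2; lra.
    apply: le_trans hy _; rewrite [X in _ <= _ + X](eq_bigl xpredT).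
      by rewrite lerDr; apply: sumr_ge0 => l _; exact: sqr_ge0.
    by move=> l; rewrite /= (leq_trans (ltnW ik))// leq_addr.
  have [z z1 hz] := hT j ji; exists z => //.
  by rewrite reflectionE !mxE v0// mulr0 oppr0 addr0.
exists (fun j x => T x (lshift k j) 0); split.
- by move=> j a x y; rewrite lT !mxE.
- move=> x; apply: le_trans (cT x); rewrite /sqn big_split_ord lerDl.
  by apply: sumr_ge0 => l _; exact: sqr_ge0.
- by move=> j; apply: hT => /=.
Qed.

End DvoretzkyRogers.

(** * Sparse sets of integers *)

Lemma infinite_nat_above (B : set nat) : infinite_set B ->
  forall m, exists n, `[< B n /\ (m <= n)%N >].
Proof.
move=> Binf m; apply: contrapT => nB; apply: Binf.
apply: (sub_finite_set _ (finite_II m)) => n Bn /=.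
by rewrite ltnNge; apply/negP => mn; apply: nB; exists n; apply/asboolP.
Qed.

(** The least element of [B] beyond the last one is taken repeatedly; minimality of [next] ensures
    that none is skipped. *)
Lemma eta_of_exists (B : set nat) : infinite_set B -> exists e, eta_of B e.
Proof.
move=> Binf; pose next m := ex_minn (infinite_nat_above B Binf m).
have nextB m : B (next m) by rewrite /next; case: ex_minnP => n /asboolP[].
have next_ge m : (m <= next m)%N by rewrite /next; case: ex_minnP => n /asboolP[].
have next_min m b : B b -> (m <= b)%N -> (next m <= b)%N.
  rewrite /next; case: ex_minnP => n _ nmin Bb mb; apply: nmin.
  exact/asboolP.
pose e := fix e n := if n is k.+1 then next (e k).+1 else next 0.
have e_lt n : (e n < e n.+1)%N by exact: next_ge.
have e_mono : {homo e : m n / (m < n)%N}.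
  by apply: homo_ltn => //; exact: ltn_trans.
have e_ge n : (n <= e n)%N by elim: n => // n IH; exact: leq_ltn_trans (e_lt n).
have eB n : B (e n) by case: n => [|n]; exact: nextB.
have e_onto n b : B b -> (b < e n)%N -> exists k, e k = b.
  elim: n => [|n IH] Bb.
    move=> be; have : (e 0 <= b)%N := next_min 0 b Bb isT.
    by move=> /(leq_trans be); rewrite ltnn.
  have [ben _|nb be|ben _] := ltngtP b (e n); first exact: IH.
    have : (e n.+1 <= b)%N := next_min _ b Bb nb.
    by move=> /(leq_trans be); rewrite ltnn.
  by exists n.
exists e; split.
  move=> m n; rewrite leEnat; exact: leq_mono.
apply/seteqP; split=> [_ [n _ <-]//|b Bb].
by have [k <-] := e_onto b.+1 b Bb (e_ge _); exists k.
Qed.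

Lemma stationary_infinite (F : set_system nat) (A : set nat) :
  free_filter F -> stationary F A -> infinite_set A.
Proof. by move=> Ff sA fA; apply: sA; apply: Ff; rewrite setCK. Qed.

(* The last cut point not exceeding [i]; when no positive [n] qualifies it is
   [0], so [f 0 <= i] is not guaranteed. *)
Definition level (f : nat -> nat) (i : nat) : nat :=
  \max_(n < i.+1 | (f n <= i)%N) n.

Section Level.
Variable f : nat -> nat.
Hypothesis f_ge : forall n, (n <= f n)%N.

Lemma level_le i : (0 < level f i)%N -> (f (level f i) <= i)%N.
Proof.
rewrite /level; case: (pickP (fun n : 'I_i.+1 => f n <= i)%N) => [n0 h0|h0].
  by rewrite (bigop.bigmax_eq_arg n0)//; case: arg_maxnP.
by rewrite big_pred0.
Qed.

Lemma level_ge n i : (f n <= i)%N -> (n <= level f i)%N.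
Proof.
(* By [f_ge], the bounded range of the maximum contains every [n] with [f n <= i]. *)
move=> fni; have ni : (n < i.+1)%N by rewrite ltnS (leq_trans _ fni).
exact: (@bigop.leq_bigmax_cond _ (fun n : 'I_i.+1 => f n <= i)%N
  (fun n => n : nat) (Ordinal ni)).
Qed.

Lemma level_mono : {homo level f : i j / (i <= j)%N}.
Proof.
move=> i j ij; have [->//|l0] := posnP (level f i).
by rewrite level_ge// (leq_trans (level_le _ l0)).
Qed.

Lemma level_lt i : (i < f (level f i).+1)%N.
Proof. by rewrite ltnNge; apply/negP => /level_ge; rewrite ltnn. Qed.

End Level.

(** The elements [e 0], ..., [e m] have level at most [nu (e m)], so [m.+1] is at most the sum of
    the bounds [g j] over these levels, and [f] of that sum is at most [e m]. *)
Lemma eta_of_ge (f g nu e : nat -> nat) (B : set nat) :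
  increasing_seq f -> eta_of B e -> {homo nu : i j / (i <= j)%N} ->
  (forall i, B i -> (f (\sum_(j < (nu i).+1) g j)%N <= i)%N) ->
  (forall n (s : seq nat), uniq s -> (forall i, i \in s -> B i /\ nu i = n) ->
    (size s <= g n)%N) ->
  forall m, (f m <= e m)%N.
Proof.
move=> f_inc [e_inc e_range] nu_mono Bf Bg m.
have f_mono : {mono f : i j / (i <= j)%N} by move=> i j; have := f_inc i j.
have e_mono : {mono e : i j / (i <= j)%N} by move=> i j; have := e_inc i j.
have eB l : B (e l) by rewrite -e_range; exists l.
apply: leq_trans (Bf _ (eB m)); rewrite f_mono ltnW//.
(* Double counting: each [l] has exactly one level [j], and exchanging the sums counts level by
   level. *)
have -> : m.+1 = (\sum_(l < m.+1) \sum_(j < (nu (e m)).+1) (nu (e l) == j))%N.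
  transitivity (\sum_(l < m.+1) 1)%N.
    by rewrite sum_nat_const card_ord muln1.
  apply: eq_bigr => l _.
  have h : (nu (e l) < (nu (e m)).+1)%N by rewrite ltnS nu_mono// e_mono -ltnS.
  rewrite (bigD1 (Ordinal h))//= eqxx big1// => j jl.
  by apply/eqP; rewrite eqb0; apply: contraNN jl => /eqP h'; apply/eqP/val_inj.
rewrite exchange_big /= leq_sum// => j _.
rewrite (_ : \sum_(l < m.+1) _ =
    size [seq e l | l <- iota 0 m.+1 & nu (e l) == j])%N.
  apply: Bg.
    rewrite map_inj_uniq ?filter_uniq ?iota_uniq//.
    by apply: (@incn_inj e) => a b; exact: e_mono.
  by move=> i /mapP[l]; rewrite mem_filter => /andP[/eqP <- _] ->.
rewrite size_map size_filter -sum1_count.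
rewrite -(big_mkord xpredT (fun l => (nu (e l) == j) : nat)).
by rewrite [RHS]big_mkcond /index_iota subn0; apply: eq_bigr => l _; case: eqP.
Qed.

(** * Growing sequences of functionals *)

Lemma ler_sum_uniq_ord (K : numDomainType) (G : nat -> K) (s : seq nat) N :
  uniq s -> (forall i, i \in s -> (i < N)%N) -> (forall i, 0 <= G i) ->
  \sum_(i <- s) G i <= \sum_(i < N) G i.
Proof.
move=> us sN G0; rewrite -(big_mkord xpredT G) [leRHS](bigID (mem s))/=.
rewrite -[X in _ <= X + _]big_filter.
rewrite [leLHS](perm_big [seq i <- index_iota 0 N | i \in s])/=.
  by rewrite lerDl sumr_ge0.
apply: uniq_perm; rewrite ?filter_uniq ?iota_uniq// => i.
rewrite mem_filter mem_index_iota /=.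
by have [/sN ->|] := boolP (i \in s).
Qed.

(* [c x] plays the role of the square norm of [x]; the functionals have norm
   about [n], yet, whatever the number [N], few of them exceed 1 at [x]. *)
Definition growing_functionals (K : numFieldType) (X : normedModType K) :=
  exists c : X -> nat, forall n N : nat, exists psi : nat -> {linear X -> K^o},
    [/\ forall j, continuous (psi j),
        forall x, \sum_(j < N) `|psi j x| ^+ 2 <= (n ^ 2 * c x)%:R &
        forall j, (j < N)%N -> exists2 y : X, `|y| <= 1 & n%:R <= 4 * `|psi j y| ].

Lemma rapid_plus_of_growing_functionals (K : numFieldType)
    (X : normedModType K) (F : set_system nat) :
  ProperFilter F -> free_filter F ->
  (forall r : K, 0 <= r -> exists n : nat, r <= n%:R) ->
  growing_functionals K X -> stationary_uniform_boundedness X F -> rapid_plus F.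
Proof.
move=> FF Ff arch [c hc] SUB I f sI f_inc; apply: contrapT => noB.
(* Level [j] will hold at most [j ^ 3] exceptional indices: this bounds [j ^ 2 * c x] once
   [c x <= j]. *)
pose h n := (\sum_(j < n.+1) j ^ 3)%N.
pose cut n := (f (h n) + n)%N.
have cut_ge n : (n <= cut n)%N by exact: leq_addl.
pose nu := level cut.
(* Indices of level [n] lie below [cut n.+1], so with this number of functionals the one used at [i]
   can be the [i]-th. *)
have [Psi hPsi] := choice (fun n => hc n (cut n.+1)).
pose T i : {linear X -> K^o} := if `[< I i >] then Psi (nu i) i else \0.
have Tcont i : continuous (T i).
  rewrite /T; case: asboolP => _; first by have [] := hPsi (nu i).
  by move=> x; exact: cvg_cst.
have small x : F [set i | `|T i x| <= 1].
  (* Up to a finite set, these are the exceptional indices at [x]. Level at least [(c x).+1], rather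
     than [c x], makes the level positive, as [level_le] needs. *)
  pose B := [set i | [/\ I i, ((c x).+1 <= nu i)%N & ~~ (`|T i x| <= 1)]].
  have count_B n (s : seq nat) : uniq s ->
      (forall i, i \in s -> B i /\ nu i = n) -> (size s <= n ^ 3)%N.
    move=> us; case: s us => // i0 s'; set s := i0 :: s' => us sB.
    have cn : (c x <= n)%N.
      by have [[_ /ltnW ci _] <-] := sB i0 (mem_head _ _).
    apply: (@leq_trans (n ^ 2 * c x)); last by rewrite [in leqRHS]expnSr leq_mul.
    have [_ /(_ x) Psum _] := hPsi n; rewrite -(ler_nat K).
    apply: le_trans _ Psum.
    apply: le_trans _ (ler_sum_uniq_ord K (fun i => `|Psi n i x| ^+ 2) s _ us _ _).
    - rewrite -sum1_size natr_sum big_seq [leRHS]big_seq ler_sum// => i /sB.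
      move=> [[Ii _ +] <-]; rewrite /T; case: asboolP => // _.
      rewrite -real_ltNge// => /ltW h1; exact: exprn_ege1.
    - by move=> i /sB[_ <-]; exact: level_lt.
    - by move=> i; rewrite exprn_ge0.
  (* A stationary [B] would be sparse enough to contradict [noB]. *)
  have nsB : ~ stationary F B.
    move=> sB; have [e he] := eta_of_exists B (stationary_infinite F B Ff sB).
    apply: noB; exists B; split=> //; first by move=> i [].
    exists e => //; apply: (eta_of_ge f (fun j => j ^ 3)%N nu e B) => //.
      exact: level_mono.
    move=> i [_ nui _]; apply: (@leq_trans (cut (nu i))); first exact: leq_addr.
    by apply: level_le => //; exact: leq_ltn_trans nui.
  have FnB : F (~` B) by exact: contrapT.
  have Fc : F [set i | (cut (c x).+1 <= i)%N].
    apply: Ff; apply: (sub_finite_set _ (finite_II (cut (c x).+1))) => i /=.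
    by move=> /negP; rewrite -ltnNge.
  apply: filterS (filterI FnB Fc) => i [nBi ci] /=.
  have [Ii|nIi] := pselect (I i); last first.
    by rewrite /T; case: asboolP => // _; rewrite normr0.
  by apply: contrapT => /negP nT; apply: nBi; split=> //; exact: level_ge.
have Tbd : pointwise_filter_bounded F T.
  move=> x V /nbhs_ballP[eps /= eps0 epsV]; exists (eps / 2).
    by rewrite divr_gt0.
  apply: filterS (small x) => i /= Tx1; apply: epsV.
  rewrite -ball_normE /= sub0r normrN normrZ gtr0_norm ?divr_gt0//.
  apply: (@le_lt_trans _ _ (eps / 2)).
    by rewrite ler_piMr// divr_ge0// ltW.
  by rewrite ltr_pdivrMr// ltr_pMr// ltr1n.
have [U [J [U0 sJ JI JU]]] :=
  SUB _ T Tcont Tbd I (ball 0 1) sI (nbhsx_ballx 0 1 ltr01).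
have [r /= r0 rU] := (nbhs_ballP _ _).1 U0.
(* The 8 is 4 times 2: the 4 comes from the lower bound in [hPsi], the 2 from testing at
   [(r / 2) *: y], strictly inside the ball of radius [r]. *)
have [n0 hn0] : exists n : nat, 1 <= n%:R * (r / 8).
  have r8 : 0 < r / 8 by rewrite divr_gt0.
  have [|n hn] := arch (r / 8)^-1; first by rewrite invr_ge0 ltW.
  by exists n; rewrite -ler_pdivrMr// div1r.
(* The infinite set [J] has an index of level at least [n0], where [T i] is too large on [U]. *)
have [i /asboolP[Ji cut_i]] :=
  infinite_nat_above J (stationary_infinite F J Ff sJ) (cut n0).
have [_ _ /(_ i (level_lt cut cut_ge i))[y y1 hy]] := hPsi (nu i).
have : ball (0 : K^o) 1 (T i ((r / 2) *: y)).
  apply: (JU i Ji); exists ((r / 2) *: y) => //; apply: rU.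
  rewrite -ball_normE /= sub0r normrN normrZ gtr0_norm ?divr_gt0//.
  apply: (@le_lt_trans _ _ (r / 2)).
    by rewrite ler_piMr// divr_ge0// ltW.
  by rewrite ltr_pdivrMr// ltr_pMr// ltr1n.
rewrite -ball_normE /= sub0r normrN linearZ normrZ gtr0_norm ?divr_gt0//.
move=> lt1; suff /le_lt_trans/(_ lt1) : 1 <= r / 2 * `|T i y| by rewrite ltxx.
apply: (le_trans hn0).
have n0nu : n0%:R <= (nu i)%:R :> K by rewrite ler_nat; exact: level_ge.
have -> : T i y = Psi (nu i) i y by rewrite /T; case: asboolP => // /(_ (JI _ Ji)).
have -> : r / 2 * `|Psi (nu i) i y| = 4 * `|Psi (nu i) i y| * (r / 8) by field.
by rewrite ler_wpM2r ?divr_ge0 ?(ltW r0)// (le_trans n0nu).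
Qed.

(** Scaling by [n] multiplies the square sum by [n ^ 2], and [c x] is a natural number above [C]
    times the squared norm of [x]. Real spaces use [C = 1], complex ones [C = 2]. *)
Lemma growing_functionals_of_square_summable (K : numFieldType)
    (X : normedModType K) (C : nat) :
  (forall r : K, 0 <= r -> exists n : nat, r <= n%:R) ->
  (forall N, exists psi : 'I_N -> X -> K,
    [/\ forall j, scalar (psi j),
        forall x, \sum_j `|psi j x| ^+ 2 <= C%:R * `|x| ^+ 2 &
        forall j, exists2 y : X, `|y| <= 1 & 1 <= 4 * `|psi j y| ]) ->
  growing_functionals K X.
Proof.
move=> arch hX.
have hc0 (x : X) : exists n : nat, C%:R * `|x| ^+ 2 <= n%:R.
  by apply: arch; rewrite mulr_ge0// exprn_ge0.
have [c hc] := choice hc0.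
exists c => n N; have [psi [lpsi spsi ypsi]] := hX N.
pose g (j : nat) (x : X) : K^o := if insub j is Some i then n%:R * psi i x else 0.
have lg j : linear (g j).
  move=> a x y; rewrite /g; case: insubP => [i _ _|_]; last by rewrite scaler0 addr0.
  by rewrite lpsi mulrDr mulrCA.
pose gl j := HB.pack_for {linear X -> K^o} (g j)
  (GRing.isLinear.Build K X K^o *:%R (g j) (lg j)).
have gE (j : 'I_N) x : gl j x = n%:R * psi j x.
  by rewrite /= /g valK.
have gsum x : \sum_(j < N) `|gl j x| ^+ 2 <= n%:R ^+ 2 * (C%:R * `|x| ^+ 2).
  under eq_bigr do rewrite gE normrM exprMn normr_nat.
  by rewrite -mulr_sumr ler_wpM2l// exprn_ge0.
exists gl; split=> [j|x|j jN].
- apply/linear_bounded_continuous/bounded_funP => r.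
  (* Here [1 + C] replaces the square root of [C], as [C <= (1 + C) ^ 2]. *)
  exists (n%:R * (1 + C%:R) * r) => x xr.
  have [jN|jN] := ltnP j N; last first.
    rewrite /= /g insubF ?ltnNge ?jN// normr0.
    by rewrite !mulr_ge0// ?addr_ge0// (le_trans _ xr).
  have r0 : 0 <= r by exact: le_trans xr.
  rewrite (gE (Ordinal jN)) normrM normr_nat -mulrA ler_wpM2l//.
  rewrite -(@ler_pXn2r _ 2)// ?nnegrE ?mulr_ge0 ?addr_ge0//.
  have h : `|psi (Ordinal jN) x| ^+ 2 <= C%:R * `|x| ^+ 2.
    apply: le_trans (spsi x); rewrite (bigD1 (Ordinal jN))//= lerDl.
    by apply: sumr_ge0 => i _; rewrite exprn_ge0.
  apply: (le_trans h); rewrite exprMn ler_pM ?exprn_ge0//.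
    by rewrite nat1r -natrX ler_nat (leq_trans (leqnSn C))// leq_pmull.
  by rewrite ler_pXn2r ?nnegrE.
- apply: (le_trans (gsum x)); rewrite natrM natrX ler_wpM2l// exprn_ge0//.
- have [y y1 hy] := ypsi (Ordinal jN); exists y => //.
  rewrite (gE (Ordinal jN)) normrM normr_nat mulrCA -[leLHS]mulr1 ler_wpM2l//.
Qed.

Lemma complex_archimedean (R : realType) (r : R[i]) :
  0 <= r -> exists n : nat, r <= n%:R.
Proof.
move=> r0; exists (Num.bound (complex.Re r)).
have rR : (complex.Re r)%:C%C = r by rewrite RRe_real// ger0_real.
rewrite -rR -(rmorph_nat (real_complex R)) lecR ltW// archi_boundP//.
by rewrite -ler0c rR.
Qed.

Lemma real_archimedean (R : realType) (r : R) :
  0 <= r -> exists n : nat, r <= n%:R.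
Proof. by move=> r0; exists (Num.bound r); rewrite ltW// archi_boundP. Qed.

Lemma growing_functionals_real (R : realType) (X : normedModType R) :
  infinite_dimensional X -> growing_functionals R X.
Proof.
move=> Xinf; apply: (growing_functionals_of_square_summable R X 1).
  exact: real_archimedean.
move=> N; have [|||phi [lphi sphi yphi]] :=
    dvoretzky_rogers R X (fun x => `|x|) _ _ _ Xinf N.
- exact: ler_normD.
- by move=> a x; rewrite normrZ.
- by move=> x /eqP; rewrite normr_eq0 => /eqP.
exists phi; split=> [//|x|j].
  rewrite mul1r; under eq_bigr do rewrite real_normK ?num_real//.
  exact: sphi.
by have [y y1 hy] := yphi j; exists y => //; lra.
Qed.

(** * Complex spaces regarded as real spaces *)

Definition realification (R : realType) (X : lmodType R[i]) : Type := X.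

HB.instance Definition _ (R : realType) (X : lmodType R[i]) :=
  GRing.Zmodule.on (realification R X).

Section Realification.
Variables (R : realType) (X : lmodType R[i]).

Let rscale (a : R) (x : realification R X) : realification R X :=
  (a%:C%C *: (x : X)).

Let rscaleA a b x : rscale a (rscale b x) = rscale (a * b) x.
Proof. by rewrite /rscale scalerA rmorphM. Qed.

Let rscale1 : left_id 1 rscale.
Proof. by move=> x; rewrite /rscale rmorph1 scale1r. Qed.

Let rscaleDr : right_distributive rscale +%R.
Proof. by move=> a x y; rewrite /rscale scalerDr. Qed.

Let rscaleDl x : {morph rscale^~ x : a b / a + b}.
Proof. by move=> a b; rewrite /rscale rmorphD scalerDl. Qed.

HB.instance Definition _ := GRing.Zmodule_isLmodule.Build R (realification R X)
  rscaleA rscale1 rscaleDr rscaleDl.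

Lemma realification_infinite_dimensional :
  infinite_dimensional X -> infinite_dimensional (realification R X).
Proof.
move=> Xinf [n [v hv]]; apply: Xinf; exists n, v => x.
by have [c xE] := hv x; exists (fun i => (c i)%:C%C).
Qed.

End Realification.

(** The complex-linear [psi j] has real part [phi j], and its squared modulus at [x] adds the
    squares of [phi j] at [x] and at ['i%C *: x], two vectors of equal norm; hence the constant
    2. *)
Lemma growing_functionals_complex (R : realType) (X : normedModType R[i]) :
  infinite_dimensional X -> growing_functionals R[i] X.
Proof.
move=> Xinf; apply: (growing_functionals_of_square_summable R[i] X 2).
  exact: complex_archimedean.
(* The norm of [X] takes values in [R[i]], whereas a real-valued one is required. *)
pose p (x : realification R X) := complex.Re `|x : X|.
have pC x : (p x)%:C%C = `|x : X| by rewrite RRe_real// normr_real.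
move=> N; have [|||phi [lphi sphi yphi]] := dvoretzky_rogers R
    (realification R X) p _ _ _ (realification_infinite_dimensional R X Xinf) N.
- by move=> x y; rewrite -lecR rmorphD /= !pC; exact: ler_normD.
- move=> a x; apply: (@complexI R); rewrite rmorphM /= !pC normrZ.
  by rewrite normc_def /= expr0n addr0 sqrtr_sqr.
- move=> x px; apply/eqP; rewrite -(normr_eq0 (x : X)) -pC px.
  by rewrite rmorph0.
have phiD j x y : phi j (x + y) = phi j x + phi j y.
  by have := lphi j 1 x y; rewrite !scale1r mul1r.
have phi0 j : phi j 0 = 0 by have := phiD j 0 0; rewrite addr0; lra.
have phiZ j a (x : X) : phi j (a%:C%C *: x) = a * phi j x.
  by have := lphi j a x 0; rewrite !addr0 phi0 addr0.
pose psi j (x : X) : R[i] := (phi j x -i* phi j ('i%C *: x))%C.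
have psi2 j x : `|psi j x| ^+ 2 =
    (phi j x ^+ 2 + phi j ('i%C *: x) ^+ 2)%:C%C.
  by rewrite -add_Re2_Im2 /= sqrrN.
exists psi; split=> [j [a b] x y|x|j].
- have abx (z : X) : (a +i* b)%C *: z = a%:C%C *: z + b%:C%C *: ('i%C *: z).
    by rewrite scalerA -scalerDl [X in X *: _]complexE [_ * b%:C%C]mulrC.
  have iabx : 'i%C *: ((a +i* b)%C *: x) =
      a%:C%C *: ('i%C *: x) + (- b)%:C%C *: x.
    rewrite !scalerA -scalerDl; congr (_ *: _).
    by apply/eqP; rewrite eq_complex /=; apply/andP; split; apply/eqP; ring.
  rewrite /psi scalerDr iabx abx !phiD !phiZ.
  by apply/eqP; rewrite eq_complex /=; apply/andP; split; apply/eqP; ring.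
- under eq_bigr do rewrite psi2.
  rewrite -rmorph_sum -pC -rmorphXn -(rmorph_nat (real_complex R)) -rmorphM lecR.
  rewrite big_split /=.
  have pix : p ('i%C *: x) = p x.
    apply: (@complexI R); rewrite !pC normrZ normc_def /=.
    by rewrite expr0n expr1n add0r sqrtr1 rmorph1 mul1r.
  have := sphi ('i%C *: x); have := sphi x; rewrite pix; lra.
- have [y y1 hy] := yphi j; exists y.
    by rewrite -pC -(rmorph1 (real_complex R)) lecR.
  (* The lower bound survives because the modulus dominates the real part. *)
  have := normc_ge_Re (psi j y); rewrite /= => h.
  apply: le_trans (_ : 4 * `|phi j y|%:C%C <= _); last by rewrite ler_wpM2l.
  by rewrite -(rmorph1 (real_complex R)) -(rmorph_nat (real_complex R)) -rmorphM lecR; lra.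
Qed.

Theorem lemma4p4 (R : realType) (F : set_system nat) (FF : ProperFilter F)
    (Ffree : free_filter F) :
  (forall X : normedModType R, infinite_dimensional X ->
     stationary_uniform_boundedness X F -> rapid_plus F) /\
  (forall X : normedModType R[i], infinite_dimensional X ->
     stationary_uniform_boundedness X F -> rapid_plus F).
Proof.
split=> X Xinf; apply: rapid_plus_of_growing_functionals => //.
- exact: real_archimedean.
- exact: growing_functionals_real.
- exact: complex_archimedean.
- exact: growing_functionals_complex.
Qed.
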